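(* Let $(\mathfrak{A},\mathfrak{B},\iota,\mathfrak{S})$ be a spectral duality. Then the functor $$\iota_*:\mathfrak{A}_*\longrightarrow\mathfrak{B}_*$$ obtained by restricting $\iota$ to the fibers over the one-point space $*$ is a right multi-adjoint.
   Context: **Fibered categories of spatial objects.** All categories are over $\mathcal{T}op^{op}$: for $\mathfrak{B}\to\mathcal{T}op^{op}$ write $|\mathbb{B}|$ for the underlying space of an object; an arrow $h:\mathbb{B}\to\mathbb{C}$ of $\mathfrak{B}$ lies over a continuous map $|h|:|\mathbb{C}|\to|\mathbb{B}|$ (reversed direction). *Fibration (inverse image lifts)*: for every $\mathbb{B}$ and continuous $f:X\to|\mathbb{B}|$ there is an arrow $\overline f:\mathbb{B}\to f^*\mathbb{B}$ over $f$ such that for each $h:\mathbb{B}\to\mathbb{C}$ and each continuous $g:|\mathbb{C}|\to X$ with $f\circ g=|h|$ there is a unique $k:f^*\mathbb{B}\to\mathbb{C}$ over $g$ with $k\circ\overline f=h$. *Opfibration (direct image lifts)*: for every $\mathbb{C}$ and continuous $f:|\mathbb{C}|\to Y$ there is an arrow $\overline f:f_*\mathbb{C}\to\mathbb{C}$ over $f$ such that for each $h:\mathbb{B}\to\mathbb{C}$ and each continuous $g:Y\to|\mathbb{B}|$ with $g\circ f=|h|$ there is a unique $k:\mathbb{B}\to f_*\mathbb{C}$ over $g$ with $\overline f\circ k=h$. **Spectral duality.** A quadruple $(\mathfrak{A},\mathfrak{B},\iota,\mathfrak{S})$ where $\mathfrak{A}$ and $\mathfrak{B}$ are fibrations over $\mathcal{T}op^{op}$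 (every object has inverse image lifts along every continuous map into its underlying space), $\mathfrak{B}$ is moreover an opfibration over $\mathcal{T}op^{op}$ (every object has direct image lifts along every continuous map out of its underlying space), $\iota:\mathfrak{A}\to\mathfrak{B}$ is a strict morphism of fibrations (it commutes strictly with the projections to $\mathcal{T}op^{op}$ and preserves inverse image lifts), and $\mathfrak{S}:\mathfrak{B}\to\mathfrak{A}$ is left adjoint to $\iota$, $\mathfrak{S}\dashv\iota$ (with no requirement that $\mathfrak{S}$ commute with the projections). **Fibers.** $\mathfrak{A}_*$ and $\mathfrak{B}_*$ are the fibers over the one-point space $*$: objects over $*$ and arrows over $1_*$. **Right multi-adjoint.** A functor $U:\mathcal{A}\to\mathcal{B}$ is right multi-adjoint if for every object $B$ of $\mathcal{B}$ the comma category $B\downarrow U$ has a small initial family: there are a set $X_B$ and arrows $x:B\to U(A_x)$, $x\in X_B$, such that for every $f:B\to U(A)$ there are a unique $x\in X_B$ and a unique $u:A_x\to A$ in $\mathcal{A}$ with $f=U(u)\circ x$. *)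

(* Defs.v *)
From HB Require Import structures.
From mathcomp Require Import all_boot.
From mathcomp Require Import all_classical topology.

Set Implicit Arguments.
Unset Strict Implicit.
Unset Printing Implicit Defensive.

Declare Scope cat_scope.
Delimit Scope cat_scope with cat.

Record category := Category {
  obj :> Type;
  hom : obj -> obj -> Type;
  idc : forall A, hom A A;
  comp : forall A B C, hom B C -> hom A B -> hom A C;
  comp1c : forall A B (f : hom A B), comp (idc B) f = f;
  compc1 : forall A B (f : hom A B), comp f (idc A) = f;
  compcA : forall A B C D (h : hom C D) (g : hom B C) (f : hom A B),
    comp h (comp g f) = comp (comp h g) f
}.
Arguments hom {c} A B.
Arguments idc {c} A.
Arguments comp {c A B C} g f.

Notation "g \o f" := (comp g f) : cat_scope.
Local Open Scope cat_scope.

Definition op (C : category) : category := {|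
  obj := C;
  hom := fun X Y => @hom C Y X;
  idc := fun X => idc X;
  comp := fun X Y Z g f => @comp C Z Y X f g;
  comp1c := fun X Y f => compc1 f;
  compc1 := fun X Y f => comp1c f;
  compcA := fun X Y Z T h g f => esym (compcA f g h)
|}.

Record functor (C D : category) := Functor {
  fobj :> C -> D;
  fhom : forall A B, hom A B -> hom (fobj A) (fobj B);
  fhom1 : forall A, fhom (idc A) = idc (fobj A);
  fhomM : forall A B X (g : hom B X) (f : hom A B),
    fhom (g \o f) = fhom g \o fhom f
}.
Arguments fhom {C D} f {A B} h : rename.

Record adjunction (C D : category) (L : functor C D) (R : functor D C) :=
  Adjunction {
  unit_of : forall X : C, hom X (R (L X));
  counit_of : forall Y : D, hom (L (R Y)) Y;
  unit_natural : forall (X X' : C) (f : hom X X'),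
    unit_of X' \o f = fhom R (fhom L f) \o unit_of X;
  counit_natural : forall (Y Y' : D) (g : hom Y Y'),
    counit_of Y' \o fhom L (fhom R g) = g \o counit_of Y;
  triangle_left : forall X : C,
    counit_of (L X) \o fhom L (unit_of X) = idc (L X);
  triangle_right : forall Y : D,
    fhom R (counit_of Y) \o unit_of (R Y) = idc (R Y)
}.

(* Heterogeneous equality [P h = f]: it includes the equalities of the domains
   and of the codomains of [P h] and [f]. *)
Inductive lies_over (E C : category) (P : functor E C) (A B : E)
    (h : hom A B) : forall X Y : C, hom X Y -> Prop :=
  | LiesOver : @lies_over E C P A B h (P A) (P B) (fhom P h).
Arguments lies_over {E C} P {A B} h {X Y} f.

Section LiesOver.
Variables (E C : category) (P : functor E C).

Definition hom_cast (D : category) (X Y X' Y' : D)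
    (eX : X = X') (eY : Y = Y') (f : hom X Y) : hom X' Y' :=
  match eX in _ = X1, eY in _ = Y1 return hom X1 Y1 with
  | erefl, erefl => f
  end.

Lemma lies_overP (A B : E) (h : hom A B) (X Y : C) (f : hom X Y) :
  lies_over P h f <->
  exists (eX : P A = X) (eY : P B = Y), f = hom_cast eX eY (fhom P h).
Proof.
split; first by case; exists erefl, erefl.
by case=> eX [eY ->]; subst X Y.
Qed.

Lemma lies_over_cast (A B : E) (h : hom A B) (X Y X' Y' : C)
    (eX : X = X') (eY : Y = Y') (f : hom X Y) :
  lies_over P h f -> lies_over P h (hom_cast eX eY f).
Proof. by subst X' Y'. Qed.

Lemma lies_over1 (A : E) (X : C) : P A = X -> lies_over P (idc A) (idc X).
Proof. by case: X / => /=; rewrite -(fhom1 P); exact: LiesOver. Qed.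

Lemma lies_overM (A B D : E) (X Y Z : C) (h : hom A B) (k : hom B D)
    (f : hom X Y) (g : hom Y Z) :
  lies_over P h f -> lies_over P k g -> lies_over P (k \o h) (g \o f).
Proof.
move=> /lies_overP[eX [eY ->]] /lies_overP[eY' [eZ ->]].
rewrite (Prop_irrelevance eY' eY).
subst X Y Z => /=; rewrite -fhomM; exact: LiesOver.
Qed.

Definition fiber_hom (X : C) (A B : {A : E | P A = X}) : Type :=
  {h : hom (sval A) (sval B) | lies_over P h (idc X)}.

Definition fiber_id (X : C) (A : {A : E | P A = X}) : fiber_hom A A :=
  exist _ (idc (sval A)) (lies_over1 (svalP A)).

Lemma fiber_comp_subproof (X : C) (A B D : {A : E | P A = X})
    (k : fiber_hom B D) (h : fiber_hom A B) :
  lies_over P (sval k \o sval h) (idc X).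
Proof. by have := lies_overM (svalP h) (svalP k); rewrite comp1c. Qed.

Definition fiber_comp (X : C) (A B D : {A : E | P A = X})
    (k : fiber_hom B D) (h : fiber_hom A B) : fiber_hom A D :=
  exist _ (sval k \o sval h) (fiber_comp_subproof k h).

Lemma fiber_hom_eq (X : C) (A B : {A : E | P A = X}) (h k : fiber_hom A B) :
  sval h = sval k -> h = k.
Proof.
case: h k => [h hX] [k kX] /= e; subst k; congr exist; exact: Prop_irrelevance.
Qed.

Definition fiber (X : C) : category.
refine {|
  obj := {A : E | P A = X};
  hom := @fiber_hom X;
  idc := @fiber_id X;
  comp := @fiber_comp X |}.
- by move=> A B f; apply: fiber_hom_eq; exact: comp1c.
- by move=> A B f; apply: fiber_hom_eq; exact: compc1.
- by move=> A B D F h g f; apply: fiber_hom_eq; exact: compcA.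
Defined.

End LiesOver.

Section FiberFunctor.
Variables (E F C : category) (P : functor E C) (Q : functor F C).
Variable i : functor E F.
Hypothesis i_over :
  forall (A B : E) (h : hom A B), lies_over Q (fhom i h) (fhom P h).

Lemma fiber_functor_obj_subproof (X : C) (A : fiber P X) :
  Q (i (sval A)) = X.
Proof.
by have /lies_overP[e _] := i_over (idc (sval A)); rewrite e (svalP A).
Qed.

Lemma fiber_functor_hom_subproof (X : C) (A B : fiber P X) (h : hom A B) :
  lies_over Q (fhom i (sval h)) (idc X).
Proof.
case: A B h => [A AX] [B BX] [/= h /lies_overP[eA [eB ->]]] {AX BX}.
exact: lies_over_cast (i_over h).
Qed.

Definition fiber_functor (X : C) : functor (fiber P X) (fiber Q X).
refine {|
  fobj := fun A : fiber P X =>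
    exist _ (i (sval A)) (fiber_functor_obj_subproof A) : fiber Q X;
  fhom := fun (A B : fiber P X) (h : hom A B) =>
    exist _ (fhom i (sval h)) (fiber_functor_hom_subproof h) |}.
- by move=> A; apply: fiber_hom_eq; exact: fhom1.
- by move=> A B D g f; apply: fiber_hom_eq; exact: fhomM.
Defined.

End FiberFunctor.

(* The universe of the carriers of topological spaces: "small" means living in
   this universe, while categories may live in larger ones. *)
Definition SmallType := Type@{Topological.axioms_.u0}.

Definition right_multi_adjoint (A B : category) (U : functor A B) : Prop :=
  forall b : B,
  exists (X : SmallType) (a : X -> A) (eta : forall x : X, hom b (U (a x))),
  forall (c : A) (f : hom b (U c)),
  exists! p : {x : X & hom (a x) c},
    f = fhom U (projT2 p) \o eta (projT1 p).

Definition TopCat : category.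
refine {|
  obj := topologicalType;
  hom := fun X Y => continuousType X Y;
  idc := fun X => idfun : continuousType X X;
  comp := fun X Y Z (g : continuousType Y Z) (f : continuousType X Y) =>
    (g \o f)%FUN : continuousType X Z |}.
- by move=> X Y f; apply/continuousEP.
- by move=> X Y f; apply/continuousEP.
- by move=> X Y Z T h g f; apply/continuousEP.
Defined.

Definition one_point : TopCat := discrete_topology unit.

Record spatial_category := SpatialCategory {
  spatial_cat :> category;
  proj : functor spatial_cat (op TopCat)
}.

Section Lifts.
Variable E : spatial_category.

Definition space (B : E) : TopCat := proj E B.

Definition space_map (B C : E) (h : hom B C) : hom (space C) (space B) :=
  fhom (proj E) h.

Definition arrow_over (B C : E) (h : hom B C) (Y X : TopCat) (f : hom Y X) :
  Prop := @lies_over E (op TopCat) (proj E) B C h X Y f.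

(* The map along which one lifts is [space_map h]; the space X (or Y) is
   [space D], so that the universal property needs no transport. *)
Definition inverse_image_lift (B D : E) (h : hom B D) : Prop :=
  forall (C : E) (k : hom B C) (g : hom (space C) (space D)),
    space_map h \o g = space_map k ->
    exists! l : hom D C, space_map l = g /\ l \o h = k.

Definition direct_image_lift (D C : E) (h : hom D C) : Prop :=
  forall (B : E) (k : hom B C) (g : hom (space D) (space B)),
    g \o space_map h = space_map k ->
    exists! l : hom B D, space_map l = g /\ h \o l = k.

Definition fibration : Prop :=
  forall (B : E) (X : TopCat) (f : hom X (space B)),
  exists (D : E) (h : hom B D), arrow_over h f /\ inverse_image_lift h.

Definition opfibration : Prop :=
  forall (C : E) (Y : TopCat) (f : hom (space C) Y),
  exists (D : E) (h : hom D C), arrow_over h f /\ direct_image_lift h.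

End Lifts.

(* [strict_over] entails [proj F (i A) = proj E A] on objects. *)
Record strict_morphism (E F : spatial_category) := StrictMorphism {
  strict_functor :> functor E F;
  strict_over : forall (A B : E) (h : hom A B),
    lies_over (proj F) (fhom strict_functor h) (fhom (proj E) h);
  strict_lift : forall (A B : E) (h : hom A B),
    inverse_image_lift h -> inverse_image_lift (fhom strict_functor h)
}.

Record spectral_duality := SpectralDuality {
  sd_A : spatial_category;
  sd_B : spatial_category;
  sd_A_fibration : fibration sd_A;
  sd_B_fibration : fibration sd_B;
  sd_B_opfibration : opfibration sd_B;
  sd_iota : strict_morphism sd_A sd_B;
  sd_S : functor sd_B sd_A;
  sd_adjunction : adjunction sd_S sd_iota
}.

Definition iota_point (D : spectral_duality) :
  functor (fiber (proj (sd_A D)) one_point)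
          (fiber (proj (sd_B D)) one_point) :=
  fiber_functor (@strict_over _ _ (sd_iota D)) one_point.

(* Main.v *)
From mathcomp Require Import all_boot.
From mathcomp Require Import all_classical topology.
Require Import Defs.

Set Implicit Arguments.
Unset Strict Implicit.
Unset Printing Implicit Defensive.

Local Open Scope cat_scope.

(* For [b] over the point, the initial family of [b] is indexed by the points
   [x] of the space of the spectrum [S b], and its member at [x] is the unit
   [b -> iota (S b)] followed by the image of the inverse image lift
   [S b -> x^* (S b)]. Indeed an arrow [b -> iota c] corresponds by adjunction
   to an arrow [S b -> c]; if [c] is over the point, this arrow lies over a
   unique point [x], and it factors uniquely through the lift along [x]. *)

(** The equalities of objects hidden in [lies_over] are proof irrelevant, so both transports of
    [fhom P h] agree. *)
Lemma lies_over_inj (E C : category) (P : functor E C) (A B : E) (h : hom A B)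
    (X Y : C) (f g : hom X Y) :
  lies_over P h f -> lies_over P h g -> f = g.
Proof.
move=> /lies_overP[eX [eY ->]] /lies_overP[eX' [eY' ->]].
by rewrite (Prop_irrelevance eX eX') (Prop_irrelevance eY eY').
Qed.

Lemma lies_over_idP (E C : category) (P : functor E C) (A B : E) (h : hom A B)
    (X : C) (eA : P A = X) (eB : P B = X) :
  lies_over P h (idc X) <-> hom_cast eA eB (fhom P h) = idc X.
Proof.
split=> [/lies_overP[eA' [eB' ->]]|<-].
  by rewrite (Prop_irrelevance eA eA') (Prop_irrelevance eB eB').
by apply/lies_overP; exists eA, eB.
Qed.

Lemma one_point_terminal (X : TopCat) (f g : hom X one_point) : f = g.
Proof. by apply/continuousEP => x; case: (f x); case: (g x). Qed.

(** Verticality over the point is automatic, as [one_point] is terminal. This puts the unit followed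
    by a lift in the fiber, although the unit itself need not be vertical. *)
Lemma lies_over_one_point (E : spatial_category) (A B : E) (h : hom A B) :
  proj E A = one_point -> proj E B = one_point ->
  lies_over (proj E) h (idc (one_point : op TopCat)).
Proof.
by move=> eA eB; apply/(lies_over_idP h eA eB); exact: one_point_terminal.
Qed.

Lemma inverse_image_lift_vertical (E : spatial_category) (B D C : E)
    (h : hom B D) (k : hom B C) (X : TopCat) (f : hom X (space B)) :
  inverse_image_lift h -> arrow_over h f -> arrow_over k f ->
  exists! l : hom D C, arrow_over l (idc X) /\ l \o h = k.
Proof.
move=> lift /lies_overP[eB [eD ->]] /lies_overP[eB' [eC]].
rewrite (Prop_irrelevance eB erefl) (Prop_irrelevance eB' erefl) => {eB eB'}.
subst X => /= hk.
(* The identity of [X], transported to a map between the two spaces, which are equal only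
   propositionally; the universal property of [h] is applied to it. *)
pose g : hom (space C) (space D) :=
  hom_cast (D := op TopCat) eC erefl (idc (space C : op TopCat)).
have gP (l : hom D C) : space_map l = g <-> arrow_over l (idc (space D)).
  rewrite /arrow_over (lies_over_idP l (erefl _) eC) /g /space_map /space.
  move: (fhom (proj E) l) => /= m.
  clear g hk; move: m; rewrite /space.
  by move: (proj E D) eC => Y eC; case: Y / eC.
have hg : space_map h \o g = space_map k.
  move: hk; rewrite /g /space_map /space.
  move: (fhom (proj E) h) (fhom (proj E) k) => /= m n; clear g gP; move: m n.
  by rewrite /space; move: (proj E D) eC => Y eC; case: Y / eC => m n /= ->;
    exact: (@compc1 TopCat).
have [l [[lg lh] luniq]] := lift C k g hg.
exists l; split; first by split=> //; apply/gP.
by move=> l' [/gP l'g l'h]; exact: luniq.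
Qed.

Lemma adjunction_transpose (C D : category) (L : functor C D) (R : functor D C)
    (adj : adjunction L R) (X : C) (Y : D) (f : hom X (R Y)) (g : hom (L X) Y) :
  f = fhom R g \o unit_of adj X <-> counit_of adj Y \o fhom L f = g.
Proof.
split=> [->|<-].
  by rewrite fhomM compcA counit_natural -compcA triangle_left compc1.
by rewrite fhomM -compcA -unit_natural compcA triangle_right comp1c.
Qed.

Theorem theorem3p8 (D : spectral_duality) :
  right_multi_adjoint (iota_point D).
Proof.
move=> b; set i := sd_iota D; set adj := sd_adjunction D.
pose Sb := sd_S D (sval b).
(* Points are taken as maps from [one_point], ready to be lifted along; they form a small type
   because spaces have small carriers. *)
pose X : SmallType := hom one_point (space Sb).
have /choice[d dP] : forall x : X, exists d : {d : sd_A D & hom Sb d},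
    arrow_over (projT2 d) x /\ inverse_image_lift (projT2 d).
  by move=> x; have [d [h hP]] := sd_A_fibration x; exists (existT _ d h).
pose c x : hom Sb (projT1 (d x)) := projT2 (d x).
have cx x : arrow_over (c x) x := (dP x).1.
have cP x : inverse_image_lift (c x) := (dP x).2.
have dpt x : proj (sd_A D) (projT1 (d x)) = one_point.
  by have /lies_overP[eS [ed _]] := cx x.
pose a (x : X) : fiber (proj (sd_A D)) one_point :=
  exist _ (projT1 (d x)) (dpt x).
have etapt (x : X) : lies_over (proj (sd_B D))
    (fhom i (c x) \o unit_of adj (sval b)) (idc (one_point : op TopCat)).
  apply: lies_over_one_point (svalP b) _.
  exact: (svalP (iota_point D (a x))).
pose eta (x : X) : hom b (iota_point D (a x)) := exist _ _ (etapt x).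
exists X, a, eta => C f.
pose g : hom Sb (sval C) := counit_of adj (sval C) \o fhom (sd_S D) (sval f).
(* Factoring [f] through [eta x] amounts, by transposition, to factoring [g] through the lift
   [c x]. *)
have factorP x (u : hom (a x) C) :
    f = fhom (iota_point D) u \o eta x <-> sval u \o c x = g.
  have -> : (f = fhom (iota_point D) u \o eta x) <->
      sval f = fhom i (sval u \o c x) \o unit_of adj (sval b).
    by rewrite fhomM -compcA; split=> [->//|e]; exact: fiber_hom_eq.
  by rewrite adjunction_transpose; split=> /esym.
pose x : X := hom_cast (D := op TopCat) erefl (svalP C) (space_map g).
have gx : arrow_over g x by apply/lies_overP; exists erefl, (svalP C).
have [u [[upt uc] uuniq]] := inverse_image_lift_vertical (cP x) (cx x) gx.
exists (existT _ x (exist _ u upt : hom (a x) C)); split.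
  exact/factorP.
case=> y v /= /factorP vc.
(* Since [v] is vertical, [v] after [c y] lies over [y]; but it equals [g], which lies over [x]. *)
have yx : y = x.
  have := lies_overM (cx y) (svalP v); rewrite vc comp1c => gy.
  exact: lies_over_inj gy gx.
subst y; congr existT; apply: fiber_hom_eq => /=.
by apply: uuniq; split=> //; exact: svalP v.
Qed.
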